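(* Let $p$ and $q$ be integers with $|p| > 1$ and $|q| > 1$, and let $G_{p,q}$ be the group with presentation $G_{p,q} = \langle x, y : x^p = y^q \rangle$. Then $G_{p,q}$ contains a generalized torsion element, namely the commutator $[x, y]$.
   Context: For elements $x, y$ of a group, $x^y := y^{-1}xy$ and $[x,y] := x^{-1}y^{-1}xy$. The identity of a group is denoted by $1$. A generalized torsion element of a group $G$ is an element $g \in G$, $g \neq 1$, for which some nonempty finite product of conjugates of $g$ is the identity, i.e. there exist $k \ge 1$ and $y_1, \dots, y_k \in G$ with $g^{y_1} g^{y_2} \cdots g^{y_k} = 1$. *)

(* Defs.v *)
From HB Require Import structures.
From mathcomp Require Import all_boot all_order all_algebra.
From mathcomp Require Import boolp.

Set Implicit Arguments.
Unset Strict Implicit.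
Unset Printing Implicit Defensive.

Import Order.TTheory GRing.Theory Num.Theory.
Local Open Scope quotient_scope.
Local Open Scope group_scope.

(* Words in the letters x and x^-1 for x in X: (x, false) stands for x and
   (x, true) for x^-1. *)
Notation word X := (seq (X * bool)).

(* The group with generators X and relations u = v for all u, v with R u v is
   the set of words modulo the least congruence containing the free
   cancellations and the relations. [Grp] in fingroup.presentation only
   characterizes finite groups, hence this construction. *)
Section Presentation.
Variables (X : choiceType) (R : word X -> word X -> Prop).
Implicit Types u v w : word X.

Inductive word_eqv : word X -> word X -> Prop :=
| word_eqv_refl u : word_eqv u u
| word_eqv_sym u v : word_eqv u v -> word_eqv v u
| word_eqv_trans u v w : word_eqv u v -> word_eqv v w -> word_eqv u w
| word_eqv_cat u u' v v' :
    word_eqv u u' -> word_eqv v v' -> word_eqv (u ++ v) (u' ++ v')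
| word_eqv_cancel x b : word_eqv [:: (x, b); (x, ~~ b)] [::]
| word_eqv_rel u v : R u v -> word_eqv u v.

Definition word_eqb u v : bool := `[< word_eqv u v >].

Fact word_eqb_refl : reflexive word_eqb.
Proof. by move=> u; apply/asboolP; apply: word_eqv_refl. Qed.

Fact word_eqb_sym : symmetric word_eqb.
Proof. by move=> u v; apply/asboolP/asboolP; apply: word_eqv_sym. Qed.

Fact word_eqb_trans : transitive word_eqb.
Proof.
move=> v u w /asboolP uv /asboolP vw; apply/asboolP.
exact: word_eqv_trans uv vw.
Qed.

Canonical word_equiv :=
  EquivRel word_eqb word_eqb_refl word_eqb_sym word_eqb_trans.

Definition presented : Type := {eq_quot word_equiv}.

HB.instance Definition _ := Choice.on presented.
HB.instance Definition _ := EqQuotient.on presented.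

Lemma presentedP u v :
  \pi_presented u = \pi_presented v <-> word_eqv u v.
Proof.
split=> [/eqP|uv]; first by rewrite eqmodE => /asboolP.
by apply/eqP; rewrite eqmodE; apply/asboolP.
Qed.

Lemma presentedW (P : presented -> Prop) :
  (forall u, P (\pi_presented u)) -> forall a, P a.
Proof. by move=> Ppi a; rewrite -[a]reprK. Qed.

Lemma repr_word_eqv u : word_eqv (repr (\pi_presented u)) u.
Proof. by apply/presentedP; rewrite reprK. Qed.

Definition word_inv u : word X := rev [seq (l.1, ~~ l.2) | l <- u].

Lemma cat_word_inv u : word_eqv (u ++ word_inv u) [::].
Proof.
elim: u => [|[x b] u IHu]; first exact: word_eqv_refl.
rewrite /word_inv /= rev_cons -cats1 catA.
apply: word_eqv_trans (word_eqv_cancel x b).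
apply: (@word_eqv_cat [:: _] [:: _] (_ ++ _) [:: _]).
  exact: word_eqv_refl.
exact: (word_eqv_cat IHu (word_eqv_refl _)).
Qed.

Lemma word_invK : involutive word_inv.
Proof.
move=> u; rewrite /word_inv map_rev revK -map_comp -[RHS]map_id.
by apply: eq_map => -[x b] /=; rewrite negbK.
Qed.

Lemma word_inv_cat u : word_eqv (word_inv u ++ u) [::].
Proof. by have := cat_word_inv (word_inv u); rewrite word_invK. Qed.

Lemma word_inv_eqv u v : word_eqv u v -> word_eqv (word_inv u) (word_inv v).
Proof.
move=> uv; apply: (@word_eqv_trans _ (word_inv u ++ (v ++ word_inv v))).
  rewrite -[X in word_eqv X _]cats0; apply: word_eqv_cat.
    exact: word_eqv_refl.
  exact/word_eqv_sym/cat_word_inv.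
rewrite catA -[X in word_eqv _ X]cat0s.
apply: word_eqv_cat; last exact: word_eqv_refl.
apply: word_eqv_trans (word_inv_cat u); apply: word_eqv_cat.
  exact: word_eqv_refl.
exact: word_eqv_sym.
Qed.

Definition presented_one : presented := \pi_presented [::].
Definition presented_mul (a b : presented) : presented :=
  \pi_presented (repr a ++ repr b).
Definition presented_inv (a : presented) : presented := \pi_presented (word_inv (repr a)).

Lemma presented_mul_pi u v :
  presented_mul (\pi_presented u) (\pi_presented v) = \pi_presented (u ++ v).
Proof.
by apply/presentedP; apply: word_eqv_cat; apply: repr_word_eqv.
Qed.

Lemma presented_inv_pi u : presented_inv (\pi_presented u) = \pi_presented (word_inv u).
Proof. by apply/presentedP; apply/word_inv_eqv/repr_word_eqv. Qed.

Fact presented_mulA : associative presented_mul.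
Proof.
elim/presentedW=> u; elim/presentedW=> v; elim/presentedW=> w.
by rewrite !presented_mul_pi catA.
Qed.

Fact presented_mul1 : left_id presented_one presented_mul.
Proof. by elim/presentedW=> u; rewrite presented_mul_pi. Qed.

Fact presented_mulr1 : right_id presented_one presented_mul.
Proof. by elim/presentedW=> u; rewrite presented_mul_pi cats0. Qed.

Fact presented_mulV : left_inverse presented_one presented_inv presented_mul.
Proof.
elim/presentedW=> u; rewrite presented_inv_pi presented_mul_pi.
exact/presentedP/word_inv_cat.
Qed.

Fact presented_mulrV : right_inverse presented_one presented_inv presented_mul.
Proof.
elim/presentedW=> u; rewrite presented_inv_pi presented_mul_pi.
exact/presentedP/cat_word_inv.
Qed.

HB.instance Definition _ := isGroup.Build presented presented_mulA
  presented_mul1 presented_mulr1 presented_mulV presented_mulrV.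

Definition presented_gen (x : X) : presented := \pi_presented [:: (x, false)].

Definition word_eval (H : groupType) (f : X -> H) u : H :=
  \prod_(l <- u) (if l.2 then (f l.1)^-1 else f l.1).

Lemma word_eval_gen u : word_eval presented_gen u = \pi_presented u.
Proof.
rewrite /word_eval; elim: u => [|[x b] u IHu]; first by rewrite big_nil.
rewrite big_cons {}IHu; case: b => /=; last exact: presented_mul_pi.
have -> : (presented_gen x)^-1 = \pi_presented [:: (x, true)].
  exact: presented_inv_pi.
exact: presented_mul_pi.
Qed.

Lemma presented_rel u v :
  R u v -> word_eval presented_gen u = word_eval presented_gen v.
Proof. by move=> uv; rewrite !word_eval_gen; exact/presentedP/word_eqv_rel. Qed.

Lemma presented_univ (H : groupType) (f : X -> H) :
    (forall u v, R u v -> word_eval f u = word_eval f v) ->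
  exists! phi : presented -> H,
    {morph phi : a b / a * b} /\ forall x, phi (presented_gen x) = f x.
Proof.
move=> fR.
have evD u v : word_eval f (u ++ v) = word_eval f u * word_eval f v.
  exact: big_cat.
have ev_eqv u v : word_eqv u v -> word_eval f u = word_eval f v.
  elim=> {u v} // [u v w _ -> _ -> //|u u' v v' _ uu _ vv|x b].
    by rewrite !evD uu vv.
  rewrite /word_eval big_cons big_seq1 big_nil /=.
  by case: b; rewrite ?mulVg ?mulgV.
exists (fun a => word_eval f (repr a)); split=> [|phi [phiM phi_gen]].
  split=> [a b|x]; first by rewrite -evD; apply/ev_eqv/repr_word_eqv.
  rewrite (ev_eqv _ _ (repr_word_eqv _)).
  by rewrite /word_eval big_seq1.
have phi1 : phi 1 = 1.
  by apply: (mulgI (phi 1)); rewrite -phiM !mulg1.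
have phiV a : phi a^-1 = (phi a)^-1.
  by apply: (mulgI (phi a)); rewrite -phiM !mulgV.
apply/funext=> a; rewrite -[in RHS](reprK a) -word_eval_gen /word_eval.
elim: (repr a) => [|[x b] u IHu]; first by rewrite !big_nil phi1.
by rewrite !big_cons phiM IHu; case: b; rewrite /= ?phiV phi_gen.
Qed.

End Presentation.

Section Torus.
Variables p q : int.

Definition word_expz (X : Type) (x : X) (n : int) : word X :=
  nseq `|n|%N (x, (n < 0)%R).

(* false is the generator x and true the generator y. *)
Definition Gpq_rel (u v : word bool) : Prop :=
  u = word_expz false p /\ v = word_expz true q.

Definition Gpq : groupType := presented Gpq_rel.
Definition Gpq_x : Gpq := presented_gen Gpq_rel false.
Definition Gpq_y : Gpq := presented_gen Gpq_rel true.

End Torus.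

Definition expgz (G : groupType) (x : G) (n : int) : G :=
  match n with Posz k => x ^+ k | Negz k => x ^- k.+1 end.

Lemma word_eval_expz (X : choiceType) (H : groupType) (f : X -> H) x n :
  word_eval f (word_expz x n) = expgz (f x) n.
Proof.
rewrite /word_eval /word_expz; case: n => k.
  by rewrite /= big_nseq -Monoid.iteropE.
by rewrite big_nseq -Monoid.iteropE; exact: expVgn.
Qed.

Lemma Gpq_xy p q : expgz (Gpq_x p q) p = expgz (Gpq_y p q) q.
Proof. by rewrite -!word_eval_expz; exact: presented_rel. Qed.

Definition generalized_torsion (G : groupType) (g : G) : Prop :=
  g <> 1 /\
  exists (k : nat) (y : 'I_k -> G), (0 < k)%N /\ \prod_(i < k) g ^ y i = 1.

(* Main.v *)
Require Import Defs.
From mathcomp Require Import all_boot all_order all_algebra.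
From mathcomp Require Import fingroup perm.

(** The element x ^ p = y ^ q commutes with y, hence so does x ^+ |p|, and
    [~ x ^+ |p|, y] = 1.  Since [~ a * b, y] = [~ a, y] ^ b * [~ b, y], the
    commutator [~ x ^+ n, y] is a product of n conjugates of [~ x, y]
    ([commXg_prod_conjg]); at n = |p| > 0 that product is trivial.

    It remains to see that x and y do not commute.  The group maps onto the
    free product of Z/p and Z/q, so it suffices to find a group with
    noncommuting elements a and b such that a ^+ |p| = 1 = b ^+ |q|
    ([Gpq_noncommute_lift]).  The wreath product of Z/p by Z/q has such a pair:
    acting on the set of pairs (i, j) with i in Z/p and j in Z/q, it is
    generated by [twist], which rotates the fibre j = 0 and fixes the others,
    and [shift], which permutes the fibres cyclically
    ([twist_shift_noncommute]). *)

Set Implicit Arguments.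
Unset Strict Implicit.
Unset Printing Implicit Defensive.

Import GRing.Theory.
Local Open Scope group_scope.

Lemma commMg_conjg (G : groupType) (x y z : G) :
  [~ x * y, z] = [~ x, z] ^ y * [~ y, z].
Proof. by rewrite /commg /conjg !invgM !mulgA !mulgK. Qed.

Lemma commXg_prod_conjg (G : groupType) (x y : G) n :
  [~ x ^+ n, y] = \prod_(i < n) [~ x, y] ^ (x ^+ (n - i.+1)).
Proof.
elim: n => [|n IHn]; first by rewrite big_ord0 expg0 comm1g.
by rewrite expgS commMg_conjg IHn big_ord_recl subn1.
Qed.

Lemma expg_absz (G : groupType) (x : G) (n : int) :
  x ^+ `|n|%N = expgz x n \/ x ^+ `|n|%N = (expgz x n)^-1.
Proof. by case: n => n /=; [left | right; rewrite invgK]. Qed.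

Lemma commute_expgz (G : groupType) (x y : G) (n : int) :
  commute x y -> commute x (expgz y n).
Proof. by case: n => n xy; [|apply: commuteV]; apply: commuteX. Qed.

Lemma expgz_absz_eq1 (G : groupType) (x : G) (n : int) :
  x ^+ `|n|%N = 1 -> expgz x n = 1.
Proof. by case: n => n /= xn1; rewrite xn1 ?invg1. Qed.

Section WreathPair.
Variables m n : nat.
Local Notation T := ('Z_m * 'Z_n)%type.

Definition twist_fun (u : T) : T := ((u.1 + (u.2 == 0)%:R)%R, u.2).
Definition shift_fun (u : T) : T := (u.1, (u.2 + 1)%R).

Lemma twist_fun_inj : injective twist_fun.
Proof.
apply: (@can_inj _ _ _ (fun u => ((u.1 - (u.2 == 0)%:R)%R, u.2))) => -[i j].
by rewrite /twist_fun /= addrK.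
Qed.

Lemma shift_fun_inj : injective shift_fun.
Proof.
apply: (@can_inj _ _ _ (fun u => (u.1, (u.2 - 1)%R))) => -[i j].
by rewrite /shift_fun /= addrK.
Qed.

Definition twist : {perm T} := perm twist_fun_inj.
Definition shift : {perm T} := perm shift_fun_inj.

Lemma twistX k (u : T) : (twist ^+ k) u = ((u.1 + (u.2 == 0)%:R *+ k)%R, u.2).
Proof.
elim: k => [|k IHk]; first by rewrite perm1 mulr0n addr0; case: u.
by rewrite expgSr permM IHk permE /twist_fun /= mulrSr addrA.
Qed.

Lemma shiftX k (u : T) : (shift ^+ k) u = (u.1, (u.2 + k%:R)%R).
Proof.
elim: k => [|k IHk]; first by rewrite perm1 addr0; case: u.
by rewrite expgSr permM IHk permE /shift_fun /= mulrSr addrA.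
Qed.

Hypotheses (m_gt1 : 1 < m) (n_gt1 : 1 < n).

Lemma twist_order : twist ^+ m = 1.
Proof.
apply/permP=> -[i j]; rewrite twistX perm1 -mulr_natr /= pchar_Zp //.
by rewrite mulr0 addr0.
Qed.

Lemma shift_order : shift ^+ n = 1.
Proof. by apply/permP=> -[i j]; rewrite shiftX perm1 /= pchar_Zp // addr0. Qed.

(** The two products send (0, 0) to (1, 1) and (0, 1) respectively: [twist]
    moves only the fibre over 0, and [shift] leaves that fibre. *)
Lemma twist_shift_noncommute : ~ commute twist shift.
Proof.
move=> /permP/(_ (0%R, 0%R)) /(congr1 fst)/eqP.
by rewrite !permM !permE.
Qed.

End WreathPair.

Section TorusGroup.
Variables p q : int.

(** Here the defining relation enters: x ^ p is also a power of y. *)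
Lemma Gpq_commuteXy : commute (Gpq_x p q ^+ `|p|%N) (Gpq_y p q).
Proof.
have yxp: commute (Gpq_y p q) (expgz (Gpq_x p q) p).
  by rewrite Gpq_xy; apply: commute_expgz.
apply: commute_sym.
by case: (expg_absz (Gpq_x p q) p) => ->; last apply: commuteV.
Qed.

(** A pair satisfying the relation is the image of (x, y) under a morphism, and
    morphisms preserve commutation. *)
Lemma Gpq_noncommute_lift (H : groupType) (a b : H) :
  expgz a p = expgz b q -> ~ commute a b -> ~ commute (Gpq_x p q) (Gpq_y p q).
Proof.
move=> ab_rel ab_nc xy.
have [|phi [[phiM phi_gen] _]] :=
  @presented_univ _ (Gpq_rel p q) H (fun c => if c then b else a).
  by move=> _ _ [-> ->]; rewrite !word_eval_expz.
apply: ab_nc; rewrite /commute -(phi_gen false) -(phi_gen true).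
by rewrite -!phiM [in LHS]xy.
Qed.

End TorusGroup.

Theorem theorem5 (p q : int) (hp : (1 < `|p|)%R) (hq : (1 < `|q|)%R) :
  generalized_torsion [~ Gpq_x p q, Gpq_y p q]%g.
Proof.
have p_gt1 : 1 < `|p|%N by rewrite -ltz_nat abszE.
have q_gt1 : 1 < `|q|%N by rewrite -ltz_nat abszE.
split.
  move/eqP/commgP.
  apply: (@Gpq_noncommute_lift p q _ (twist `|p| `|q|) (shift `|p| `|q|)).
    by rewrite !expgz_absz_eq1 ?twist_order ?shift_order.
  exact: twist_shift_noncommute.
exists `|p|%N, (fun i => Gpq_x p q ^+ (`|p|%N - i.+1)); split; first exact: ltnW.
by rewrite -commXg_prod_conjg; apply/eqP/commgP/Gpq_commuteXy.
Qed.
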